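(* Let $n\ge1$, let $\varphi_1,\dots,\varphi_n$ be analytic self-maps of $\mathbb D$, none of which is the identity map, and let $\psi_1,\dots,\psi_n$ be analytic functions on $\mathbb D$ such that $M_{\psi,\varphi}=\sum_{j=1}^n C_{\psi_j,\varphi_j}$ is bounded on the Hardy space $\mathcal H^2(\mathbb D)$. Then $0\in\overline{W(M_{\psi,\varphi})}$.
   Context: $\mathbb D$ is the open unit disk in $\mathbb C$. $C_{\psi_j,\varphi_j}$ is the weighted composition operator $C_{\psi_j,\varphi_j}f(z)=\psi_j(z)f(\varphi_j(z))$. For a bounded operator $S$ on a Hilbert space $\mathcal H$, $W(S)=\{\langle Sx,x\rangle:\ x\in\mathcal H,\ \|x\|=1\}$ is its numerical range, and the bar denotes closure in $\mathbb C$. *)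

(* Defs.v *)
From Stdlib Require Import Reals Lra ClassicalEpsilon FunctionalExtensionality.
From Coquelicot Require Import Coquelicot.

Open Scope R_scope.

(** Functions on the open unit disk are represented by total functions
    [C -> C]; every notion below depends only on their values on [disk]. *)

Definition disk (z : C) : Prop := Cmod z < 1.

Definition analytic_on_disk (f : C -> C) : Prop :=
  forall z0 : C, disk z0 ->
    exists (r : R) (a : nat -> C), 0 < r /\
      forall z : C, Cmod (z - z0)%C < r ->
        is_pseries (K := C_AbsRing) (V := C_NormedModule) a (z - z0)%C (f z).

Definition taylor_on_disk (f : C -> C) (a : nat -> C) : Prop :=
  forall z : C, disk z ->
    is_pseries (K := C_AbsRing) (V := C_NormedModule) a z (f z).

(** [hardy2 f]: the restriction of [f] to the disk belongs to H^2. *)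
Definition hardy2 (f : C -> C) : Prop :=
  exists a : nat -> C,
    taylor_on_disk f a /\ ex_series (fun k => Cmod (a k) ^ 2).

(** Junk when [f] is not given by a power series on the disk; otherwise
    characterised by [coeffs_eq] below. *)
Definition coeffs (f : C -> C) : nat -> C :=
  epsilon (inhabits (fun _ : nat => RtoC 0)) (taylor_on_disk f).

Definition h2inner (f g : C -> C) : C :=
  (Series (fun k => Re (coeffs f k * Cconj (coeffs g k))%C),
   Series (fun k => Im (coeffs f k * Cconj (coeffs g k))%C)).

Definition h2norm (f : C -> C) : R :=
  sqrt (Series (fun k => Cmod (coeffs f k) ^ 2)).

Definition bounded_on_hardy2 (S : (C -> C) -> (C -> C)) : Prop :=
  (forall f : C -> C, hardy2 f -> hardy2 (S f)) /\
  exists K : R, forall f : C -> C, hardy2 f -> h2norm (S f) <= K * h2norm f.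

Definition numerical_range (S : (C -> C) -> (C -> C)) (w : C) : Prop :=
  exists f : C -> C, hardy2 f /\ h2norm f = 1 /\ w = h2inner (S f) f.

Definition closure_C (A : C -> Prop) (z : C) : Prop :=
  forall eps : R, 0 < eps -> exists w : C, A w /\ Cmod (w - z)%C < eps.

Definition wcomp (psi phi : C -> C) (f : C -> C) : C -> C :=
  fun z => (psi z * f (phi z))%C.

Definition sum_wcomp (n : nat) (psi phi : nat -> C -> C) (f : C -> C) : C -> C :=
  fun z => sum_n_m (G := C_AbelianGroup) (fun j => wcomp (psi j) (phi j) f z) 1 n.

(** Uniqueness of the expansion, by restriction to real arguments. *)

Lemma pow_n_RtoC (x : R) (k : nat) :
  pow_n (K := C_Ring) (RtoC x) k = RtoC (x ^ k).
Proof.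
  induction k as [|k IH]; [reflexivity|].
  simpl pow_n. rewrite IH. simpl. rewrite RtoC_mult. reflexivity.
Qed.

Lemma sum_n_C (u : nat -> C) (m : nat) :
  sum_n (G := C_AbelianGroup) u m
  = (sum_n (fun k => Re (u k)) m, sum_n (fun k => Im (u k)) m).
Proof.
  induction m as [|m IH].
  - rewrite !sum_O. destruct (u 0%nat); reflexivity.
  - rewrite !sum_Sn, IH. reflexivity.
Qed.

Lemma is_series_C (u : nat -> C) (l : C) :
  is_series (K := C_AbsRing) (V := C_NormedModule) u l ->
  is_series (fun k => Re (u k)) (Re l) /\ is_series (fun k => Im (u k)) (Im l).
Proof.
  intros H.
  split; intros P [e He];
  (assert (HP : locally (T := C_UniformSpace) l
                 (fun w => ball (Re l) e (Re w) /\ ball (Im l) e (Im w)))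
    by (exists e; intros w [H1 H2]; split; assumption));
  destruct (H _ HP) as [N HN]; exists N; intros m Hm; apply He;
  destruct (HN m Hm) as [H1 H2]; rewrite sum_n_C in H1, H2; assumption.
Qed.

Lemma real_pseries_unique (a b : nat -> R) (f : R -> R) :
  (forall x, Rabs x < 1 -> is_pseries a x (f x)) ->
  (forall x, Rabs x < 1 -> is_pseries b x (f x)) ->
  forall k, a k = b k.
Proof.
  intros Ha Hb k.
  assert (R0 : forall c : nat -> R, (forall x, Rabs x < 1 -> is_pseries c x (f x)) ->
             Rbar_lt 0 (CV_radius c)).
  { intros c Hc. apply Rbar_lt_le_trans with (Rabs (1 / 2)).
    - simpl. rewrite Rabs_pos_eq; lra.
    - apply Rbar_not_lt_le. intros Hlt. apply (CV_disk_outside _ _ Hlt).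
      apply ex_series_lim_0. exists (f (1 / 2)).
      apply is_pseries_R, Hc. rewrite Rabs_pos_eq; lra. }
  apply PSeries_ext_recip; auto.
  exists (mkposreal 1 Rlt_0_1). intros x Hx.
  assert (Hx1 : Rabs x < 1).
  { change (Rabs (x - 0) < 1) in Hx. rewrite Rminus_0_r in Hx. exact Hx. }
  rewrite (is_pseries_unique _ _ _ (Ha x Hx1)).
  symmetry. apply is_pseries_unique, Hb, Hx1.
Qed.

Lemma taylor_on_disk_real (f : C -> C) (a : nat -> C) :
  taylor_on_disk f a -> forall x : R, Rabs x < 1 ->
  is_pseries (fun k => Re (a k)) x (Re (f (RtoC x))) /\
  is_pseries (fun k => Im (a k)) x (Im (f (RtoC x))).
Proof.
  intros H x Hx.
  assert (Hd : disk (RtoC x)) by (unfold disk; rewrite Cmod_R; exact Hx).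
  destruct (is_series_C _ _ (H _ Hd)) as [H1 H2].
  split; apply is_pseries_R.
  - eapply is_series_ext; [|exact H1]. intros k; cbv beta.
    rewrite pow_n_RtoC. destruct (a k) as [p q]. cbn. ring.
  - eapply is_series_ext; [|exact H2]. intros k; cbv beta.
    rewrite pow_n_RtoC. destruct (a k) as [p q]. cbn. ring.
Qed.

Lemma coeffs_eq (f : C -> C) (a : nat -> C) :
  taylor_on_disk f a -> coeffs f = a.
Proof.
  intros Ha.
  assert (Hc : taylor_on_disk f (coeffs f))
    by (unfold coeffs; apply epsilon_spec; exists a; exact Ha).
  apply functional_extensionality. intros k.
  pose proof (real_pseries_unique _ _ (fun x => Re (f (RtoC x)))
    (fun x Hx => proj1 (taylor_on_disk_real f _ Hc x Hx))
    (fun x Hx => proj1 (taylor_on_disk_real f _ Ha x Hx)) k) as H1.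
  pose proof (real_pseries_unique _ _ (fun x => Im (f (RtoC x)))
    (fun x Hx => proj2 (taylor_on_disk_real f _ Hc x Hx))
    (fun x Hx => proj2 (taylor_on_disk_real f _ Ha x Hx)) k) as H2.
  rewrite (surjective_pairing (coeffs f k)), (surjective_pairing (a k)).
  unfold Re, Im in H1, H2. rewrite H1, H2. reflexivity.
Qed.

(* Main.v *)
(** Pair [M k_w] with [k_w], where [k_w] is the normalised Szego kernel at [w].
    With [|w| = r] and [s = r^2] the value has modulus
    [(1 - s) r |sum_j psi_j(w) / (w - s phi_j(w))|]. Suppose all these are at
    least [eps]. Interpolating [t |-> 1 / (w - s t)] at the nodes [phi_j(w)]
    shows that [prod_j (w - s phi_j(w))] times the sum is a combination, with
    uniformly bounded coefficients, of the values at [w] of the H^2 functions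
    [M z^k], [k < n], which are [O((1 - s)^(-1/2))]; no control of the individual
    [psi_j] is needed. Hence [prod_j (w - s phi_j(w))] is [O((1 - s)^(1/2))] on
    the circle [|w| = r], and, being analytic in [w], on the disk [|w| <= r] by
    the maximum modulus principle. Letting [s] tend to 1 gives
    [prod_j (w - phi_j(w)) = 0] on the whole disk, which is impossible since none
    of the analytic functions [w - phi_j(w)] vanishes identically. *)

Require Import Defs.
From Stdlib Require Import Reals Lra Lia Classical ClassicalEpsilon Wf_nat.
From Coquelicot Require Import Coquelicot.

Open Scope R_scope.

(** * Isolated zeros and the identity theorem *)

(** The exclusive upper bound provides an empty sum, so remainder estimates can start at order 0,
    and [ring] sees plain complex addition. *)
Fixpoint csum (u : nat -> C) (m : nat) : C :=
  match m with O => RtoC 0 | S k => (csum u k + u k)%C end.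

Lemma csum_ext (u v : nat -> C) (m : nat) :
  (forall k, (k < m)%nat -> u k = v k) -> csum u m = csum v m.
Proof.
  induction m as [|m IH]; intros H; simpl; [reflexivity|].
  rewrite H, IH by (intros; try apply H; lia). reflexivity.
Qed.

Lemma csum_plus (u v : nat -> C) (m : nat) :
  csum (fun k => (u k + v k)%C) m = (csum u m + csum v m)%C.
Proof. induction m as [|m IH]; simpl; [ring|rewrite IH; ring]. Qed.

Lemma csum_scal (c : C) (u : nat -> C) (m : nat) :
  csum (fun k => (c * u k)%C) m = (c * csum u m)%C.
Proof. induction m as [|m IH]; simpl; [ring|rewrite IH; ring]. Qed.

Lemma csum_zero (u : nat -> C) (m : nat) :
  (forall k, (k < m)%nat -> u k = RtoC 0) -> csum u m = RtoC 0.
Proof.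
  induction m as [|m IH]; intros H; simpl; [reflexivity|].
  rewrite H, IH by (intros; try apply H; lia). ring.
Qed.

Lemma sum_n_csum (u : nat -> C) (m : nat) :
  sum_n (G := C_AbelianGroup) u m = csum u (S m).
Proof.
  induction m as [|m IH].
  - rewrite sum_O. simpl. ring.
  - rewrite sum_Sn, IH. reflexivity.
Qed.

Lemma sum_n_m_csum (u : nat -> C) (m : nat) :
  sum_n_m (G := C_AbelianGroup) u 1 m = csum (fun j => u (S j)) m.
Proof.
  induction m as [|m IH].
  - apply (sum_n_m_zero (G := C_AbelianGroup)). lia.
  - rewrite sum_n_Sm by lia. rewrite IH. reflexivity.
Qed.

Lemma is_series_Cmod (u : nat -> C) (l : C) :
  is_series (K := C_AbsRing) (V := C_NormedModule) u l <->
  forall e : R, 0 < e ->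
    exists N : nat, forall m, (N <= m)%nat -> Cmod (csum u m - l)%C < e.
Proof.
  split.
  - intros H e He.
    assert (H1 := proj1 (filterlim_locally_ball_norm
      (K := C_AbsRing) (U := C_NormedModule) (F := eventually) _ l) H (mkposreal e He)).
    destruct H1 as [N HN]. exists (S N). intros [|m] Hm; [lia|].
    specialize (HN m ltac:(lia)). rewrite sum_n_csum in HN. exact HN.
  - intros H.
    apply (filterlim_locally_ball_norm (K := C_AbsRing) (U := C_NormedModule)).
    intros e. destruct (H e (cond_pos e)) as [N HN]. exists N. intros m Hm.
    rewrite sum_n_csum. exact (HN (S m) ltac:(lia)).
Qed.

Lemma pow_n_Cpow (z : C) (k : nat) : pow_n (K := C_Ring) z k = (z ^ k)%C.
Proof. induction k as [|k IH]; simpl; [reflexivity|]. rewrite IH. reflexivity. Qed.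

Lemma is_pseries_C (a : nat -> C) (z l : C) :
  is_pseries (K := C_AbsRing) (V := C_NormedModule) a z l <->
  is_series (K := C_AbsRing) (V := C_NormedModule) (fun k => (a k * z ^ k)%C) l.
Proof.
  assert (E : forall k, scal (K := C_AbsRing) (V := C_NormedModule)
    (pow_n (K := C_AbsRing) z k) (a k) = (a k * z ^ k)%C).
  { intros k. transitivity (z ^ k * a k)%C; [|apply Cmult_comm].
    exact (f_equal (fun t => (t * a k)%C) (pow_n_Cpow z k)). }
  split; intros H; (eapply is_series_ext; [|exact H]); intros k;
    [|symmetry]; apply E.
Qed.

Lemma is_series_Cmod_bounded (u : nat -> C) (l : C) :
  is_series (K := C_AbsRing) (V := C_NormedModule) u l ->
  exists B, 0 <= B /\ forall k, Cmod (u k) <= B.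
Proof.
  intros H. destruct (proj1 (is_series_Cmod u l) H 1 Rlt_0_1) as [N HN].
  assert (Hf : exists B, 0 <= B /\ forall k, (k < N)%nat -> Cmod (u k) <= B).
  { clear HN. induction N as [|N [B [HB IH]]].
    - exists 0; split; [lra|lia].
    - exists (B + Cmod (u N)). pose proof (Cmod_ge_0 (u N)). split; [lra|].
      intros k Hk. destruct (Nat.eq_dec k N) as [->|]; [lra|].
      specialize (IH k ltac:(lia)). lra. }
  destruct Hf as [B [HB HBk]]. exists (B + 2). split; [lra|]. intros k.
  destruct (Nat.lt_ge_cases k N) as [Hk|Hk]; [specialize (HBk k Hk); lra|].
  pose proof (HN k Hk) as H1. pose proof (HN (S k) ltac:(lia)) as H2. simpl in H2.
  replace (u k) with ((csum u k + u k - l) + - (csum u k - l))%C by ring.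
  eapply Rle_trans; [apply Cmod_triangle|]. rewrite Cmod_opp. lra.
Qed.

(** A bound on all finite blocks after index [m] survives the limit: an excess would be a fixed gap
    that late partial sums cannot bridge. *)
Lemma is_series_Cmod_tail (u : nat -> C) (l : C) (m : nat) (b : R) :
  is_series (K := C_AbsRing) (V := C_NormedModule) u l ->
  (forall k, Cmod (csum u (k + m) - csum u m)%C <= b) ->
  Cmod (l - csum u m)%C <= b.
Proof.
  intros H Hb. apply Rnot_lt_le. intros Hlt.
  destruct (proj1 (is_series_Cmod u l) H (Cmod (l - csum u m)%C - b)) as [N HN]; [lra|].
  specialize (HN (N + m)%nat ltac:(lia)). specialize (Hb N).
  assert (Cmod (l - csum u m)%C <=
    Cmod (csum u (N + m) - l)%C + Cmod (csum u (N + m) - csum u m)%C); [|lra].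
  replace (l - csum u m)%C
    with (- (csum u (N + m) - l) + (csum u (N + m) - csum u m))%C by ring.
  eapply Rle_trans; [apply Cmod_triangle|]. rewrite Cmod_opp. lra.
Qed.

(** One pair [A], [B] controls the remainders of all orders, which replaces differentiation. Letting
    [m] grow detects local vanishing, [m] just past the first nonzero coefficient isolates a zero,
    and [m = 3] gives the second-order expansion. *)
Definition taylor_at (f : C -> C) (z0 : C) (a : nat -> C) (A B : R) : Prop :=
  0 < A /\ 0 <= B /\ forall (m : nat) (h : C), A * Cmod h <= / 2 ->
    Cmod (f (z0 + h) - csum (fun k => a k * h ^ k) m)%C <= B * (A * Cmod h) ^ m.

(** Convergence at distance [r / 2] bounds the terms there by some [B], so [a k] is at most
    [B (2/r)^k]. For [|h| <= r/4] the tail is then dominated by a geometric series of ratio at most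
    1/2, whence [A = 2/r] and the constant [2 B]. *)
Lemma analytic_taylor_at (f : C -> C) (z0 : C) :
  analytic_on_disk f -> disk z0 -> exists a A B, taylor_at f z0 a A B.
Proof.
  intros Hf Hz. destruct (Hf z0 Hz) as (r & a & Hr & Ha).
  assert (H1 : Cmod (z0 + RtoC (r / 2) - z0)%C < r).
  { replace (z0 + RtoC (r / 2) - z0)%C with (RtoC (r / 2)) by ring.
    rewrite Cmod_R, Rabs_pos_eq; lra. }
  pose proof (proj1 (is_pseries_C _ _ _) (Ha _ H1)) as H2.
  destruct (is_series_Cmod_bounded _ _ H2) as (B & HB & HBk).
  exists a, (2 / r), (2 * B).
  assert (HA : 0 < 2 / r) by (apply Rdiv_lt_0_compat; lra).
  split; [exact HA|]. split; [lra|]. intros m h Hh.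
  set (q := 2 / r * Cmod h) in *.
  assert (Hq : 0 <= q) by (apply Rmult_le_pos; [lra|apply Cmod_ge_0]).
  assert (Hhr : Cmod h = q * (r / 2)) by (unfold q; field; lra).
  assert (Hterm : forall k, Cmod (a k * h ^ k)%C <= B * q ^ k).
  { intros k. specialize (HBk k). rewrite Cmod_mult, Cmod_pow in HBk |- *.
    replace (z0 + RtoC (r / 2) - z0)%C with (RtoC (r / 2)) in HBk by ring.
    rewrite Cmod_R, Rabs_pos_eq in HBk by lra.
    rewrite Hhr, Rpow_mult_distr.
    pose proof (pow_le q k Hq). nra. }
  apply is_series_Cmod_tail.
  - apply is_pseries_C. replace h with (z0 + h - z0)%C at 1 by ring. apply Ha.
    replace (z0 + h - z0)%C with h by ring. rewrite Hhr. nra.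
  (* The factor [1 - (1/2)^k] makes the induction close: term [k + m] adds at most [B q^m (1/2)^k],
     exactly the increment of the right-hand side. *)
  - assert (Hk : forall k,
      Cmod (csum (fun k => a k * h ^ k) (k + m) - csum (fun k => a k * h ^ k) m)%C
      <= 2 * B * q ^ m * (1 - (/ 2) ^ k)).
    { induction k as [|k IH].
      - simpl. replace (_ - _)%C with (RtoC 0) by ring. rewrite Cmod_0. lra.
      - simpl. specialize (Hterm (k + m)%nat).
        match goal with |- Cmod ?x <= _ =>
          replace x with ((csum (fun k => a k * h ^ k) (k + m)
            - csum (fun k => a k * h ^ k) m) + a (k + m)%nat * h ^ (k + m))%C by ring end.
        eapply Rle_trans; [apply Cmod_triangle|].
        assert (B * q ^ (k + m) <= B * q ^ m * (/ 2) ^ k).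
        { rewrite pow_add, Rmult_assoc, (Rmult_comm (q ^ m)).
          apply Rmult_le_compat_l; [lra|]. apply Rmult_le_compat_r; [apply pow_le; lra|].
          apply pow_incr. lra. }
        lra. }
    intros k. eapply Rle_trans; [apply Hk|].
    assert (0 <= 2 * B * q ^ m) by (apply Rmult_le_pos; [lra|apply pow_le; lra]).
    assert (0 <= (/ 2) ^ k) by (apply pow_le; lra). nra.
Qed.

Lemma le_geom_0 (x B : R) :
  0 <= B -> (forall m : nat, x <= B * (/ 2) ^ m) -> x <= 0.
Proof.
  intros HB H. apply Rnot_lt_le. intros Hx.
  destruct (pow_lt_1_zero (/ 2) ltac:(rewrite Rabs_pos_eq; lra) (x / (B + 1))) as [N HN].
  { apply Rdiv_lt_0_compat; lra. }
  specialize (HN N ltac:(lia)). specialize (H N).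
  assert (Hp : 0 <= (/ 2) ^ N) by (apply pow_le; lra).
  rewrite Rabs_pos_eq in HN by exact Hp.
  apply (Rmult_lt_compat_l (B + 1)) in HN; [|lra].
  replace ((B + 1) * (x / (B + 1))) with x in HN by (field; lra). nra.
Qed.

(** If all Taylor coefficients vanish, the remainder bounds of every order force [f = 0] nearby.
    Otherwise the first nonzero term [a_m h^m] dominates the remainder of order [m + 1] for small
    [h]. *)
Lemma analytic_isolated_zeros (f : C -> C) (z0 : C) :
  analytic_on_disk f -> disk z0 ->
  exists rho, 0 < rho /\
    ((forall h, Cmod h < rho -> f (z0 + h)%C = RtoC 0) \/
     (forall h, h <> RtoC 0 -> Cmod h < rho -> f (z0 + h)%C <> RtoC 0)).
Proof.
  intros Hf Hz. destruct (analytic_taylor_at f z0 Hf Hz) as (a & A & B & HA & HB & H).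
  assert (HA2 : 0 < / (2 * A)) by (apply Rinv_0_lt_compat; lra).
  assert (HAs : A * / (2 * A) = / 2) by (field; lra).
  destruct (classic (forall k, a k = RtoC 0)) as [H0|H0].
  - exists (/ (2 * A)). split; [exact HA2|]. left. intros h Hh.
    apply Cmod_eq_0. apply Rle_antisym; [|apply Cmod_ge_0].
    apply (le_geom_0 _ B HB). intros m.
    assert (Hh' : A * Cmod h <= / 2) by nra.
    specialize (H m h Hh').
    rewrite csum_zero in H by (intros k _; rewrite H0; ring).
    replace (f (z0 + h) - RtoC 0)%C with (f (z0 + h)%C) in H by ring.
    eapply Rle_trans; [exact H|]. apply Rmult_le_compat_l; [exact HB|].
    apply pow_incr. split; [|exact Hh'].
    apply Rmult_le_pos; [lra|apply Cmod_ge_0].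
  - apply not_all_ex_not in H0.
    destruct (dec_inh_nat_subset_has_unique_least_element (fun k => a k <> RtoC 0))
      as (m & [Hm Hmin] & _); [intros; apply classic|exact H0|].
    assert (Ham : 0 < Cmod (a m)) by (apply Cmod_gt_0; exact Hm).
    (* A zero at [h] would give [|a_m| <= B A^(m+1) |h|], which the radius [|a_m| / D] excludes; the
       added 1 keeps [D] positive when [B = 0]. *)
    set (D := B * A ^ S m + 1).
    assert (HD : 0 < D).
    { unfold D. assert (0 <= B * A ^ S m); [|lra].
      apply Rmult_le_pos; [lra|apply pow_le; lra]. }
    exists (Rmin (/ (2 * A)) (Cmod (a m) / D)). split.
    { apply Rmin_pos; [exact HA2|apply Rdiv_lt_0_compat; lra]. }
    right. intros h Hh Hlt Hfz.
    pose proof (Rmin_l (/ (2 * A)) (Cmod (a m) / D)) as Hl.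
    pose proof (Rmin_r (/ (2 * A)) (Cmod (a m) / D)) as Hr.
    assert (Hhp : 0 < Cmod h) by (apply Cmod_gt_0; exact Hh).
    specialize (H (S m) h ltac:(nra)). simpl csum in H.
    rewrite csum_zero in H.
    2:{ intros k Hk. replace (a k) with (RtoC 0); [ring|].
        apply NNPP. intros Hne. specialize (Hmin k (fun e => Hne (eq_sym e))). lia. }
    rewrite Hfz in H.
    replace (RtoC 0 - (RtoC 0 + a m * h ^ m))%C with (- (a m * h ^ m))%C in H by ring.
    rewrite Cmod_opp, Cmod_mult, Cmod_pow, Rpow_mult_distr in H.
    assert (Hpw : 0 < Cmod h ^ m) by (apply pow_lt; lra).
    assert (Cmod (a m) <= B * A ^ S m * Cmod h).
    { apply (Rmult_le_reg_r (Cmod h ^ m)); [lra|].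
      replace (B * A ^ S m * Cmod h * Cmod h ^ m)
        with (B * (A ^ S m * Cmod h ^ S m)) by (simpl; ring). exact H. }
    assert (D * Cmod h < Cmod (a m)).
    { replace (Cmod (a m)) with (D * (Cmod (a m) / D)) by (field; lra).
      apply Rmult_lt_compat_l; lra. }
    unfold D in *. nra.
Qed.

(* The set of [t] such that [f] vanishes near [t z] is open and closed in the
   segment, so its indicator function would contradict the intermediate value
   theorem. *)
Lemma analytic_identity (f : C -> C) (z : C) (rho : R) :
  analytic_on_disk f -> disk z -> 0 < rho ->
  (forall h, Cmod h < rho -> f h = RtoC 0) -> f z = RtoC 0.
Proof.
  intros Hf Hz Hrho H0.
  set (V := fun t : R => exists e, 0 < e /\
    forall h, Cmod h < e -> f (RtoC t * z + h)%C = RtoC 0).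
  (* Clamping to [[0,1]] lets the indicator [g] be continuous on all of R, as the intermediate value
     theorem is applied to [continuity g]. *)
  set (cl := fun t : R => Rmax 0 (Rmin 1 t)).
  assert (Hcl : forall t, 0 <= cl t <= 1).
  { intros t. unfold cl, Rmax, Rmin. repeat destruct (Rle_dec _ _); lra. }
  assert (Hcl1 : forall t s, Rabs (cl s - cl t) <= Rabs (s - t)).
  { intros t s. unfold cl, Rmax, Rmin, Rabs.
    repeat (destruct (Rle_dec _ _) || destruct (Rcase_abs _)); lra. }
  set (g := fun t : R => if excluded_middle_informative (V (cl t)) then 1 else -1).
  assert (Hloc : forall t, exists e, 0 < e /\ forall s, Rabs (s - t) < e -> g s = g t).
  { intros t.
    assert (Hd : disk (RtoC (cl t) * z)%C).
    { unfold disk in *. rewrite Cmod_mult, Cmod_R, Rabs_pos_eq by apply Hcl.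
      pose proof (Hcl t). pose proof (Cmod_ge_0 z). nra. }
    destruct (analytic_isolated_zeros f _ Hf Hd) as (e & He & Hiso).
    exists e. split; [exact He|]. intros s Hs.
    assert (Hdiff : forall h : C,
      (RtoC (cl s) * z + h = RtoC (cl t) * z + (RtoC (cl s - cl t) * z + h))%C)
      by (intros h; rewrite RtoC_minus; ring).
    assert (Hsm : Cmod (RtoC (cl s - cl t) * z)%C < e).
    { rewrite Cmod_mult, Cmod_R. pose proof (Hcl1 t s). pose proof (Cmod_ge_0 z).
      unfold disk in Hz. pose proof (Rabs_pos (cl s - cl t)). nra. }
    assert (Hiff : V (cl s) <-> V (cl t)).
    { destruct Hiso as [Hv|Hn].
      - split; intros _.
        + exists e. split; [exact He|exact Hv].
        + exists (e - Cmod (RtoC (cl s - cl t) * z)%C). split; [lra|].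
          intros h Hh. rewrite Hdiff. apply Hv.
          eapply Rle_lt_trans; [apply Cmod_triangle|]. lra.
      (* If the centre is isolated, [f] vanishes near no neighbouring point: every neighbourhood
         contains a point other than the centre, because [c + d] and [c + 2 d] cannot both be
         zero. *)
      - assert (Hno : forall c : C, Cmod c < e -> ~ exists e', 0 < e' /\
          forall h, Cmod h < e' -> f (RtoC (cl t) * z + (c + h))%C = RtoC 0).
        { intros c Hc (e' & He' & Hv).
          set (d := Rmin e' (e - Cmod c) / 3).
          assert (Hm1 := Rmin_l e' (e - Cmod c)).
          assert (Hm2 := Rmin_r e' (e - Cmod c)).
          assert (Hm3 : 0 < Rmin e' (e - Cmod c)) by (apply Rmin_pos; lra).
          assert (Hd0 : exists h, Cmod h <= 2 * d /\ (c + h)%C <> RtoC 0).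
          { destruct (classic ((c + RtoC d)%C = RtoC 0)) as [E|E].
            - exists (RtoC (2 * d)). split.
              + rewrite Cmod_R, Rabs_pos_eq; unfold d; lra.
              + intros E2. assert (E3 : RtoC d = RtoC 0).
                { replace (RtoC d) with ((c + RtoC (2 * d)) - (c + RtoC d))%C
                    by (rewrite RtoC_mult; ring).
                  rewrite E, E2. ring. }
                apply RtoC_inj in E3. unfold d in E3. lra.
            - exists (RtoC d). split; [|exact E].
              rewrite Cmod_R, Rabs_pos_eq; unfold d; lra. }
          destruct Hd0 as (h & Hh1 & Hh2). apply (Hn (c + h)%C Hh2).
          - eapply Rle_lt_trans; [apply Cmod_triangle|]. unfold d in Hh1. lra.
          - apply Hv. unfold d in Hh1. lra. }
        split; intros (e' & He' & Hv); exfalso.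
        + apply (Hno _ Hsm). exists e'. split; [exact He'|].
          intros h Hh. rewrite <- Hdiff. apply Hv, Hh.
        + apply (Hno (RtoC 0)); [rewrite Cmod_0; exact He|].
          exists e'. split; [exact He'|]. intros h Hh.
          replace (RtoC 0 + h)%C with h by ring. apply Hv, Hh. }
    unfold g. destruct (excluded_middle_informative (V (cl s))) as [v1|v1],
      (excluded_middle_informative (V (cl t))) as [v2|v2]; tauto. }
  assert (Hcont : continuity g).
  { intros t e He. destruct (Hloc t) as (d & Hd & Hg). exists d. split; [exact Hd|].
    intros s [_ Hs]. simpl. unfold R_dist. rewrite (Hg s Hs), Rminus_diag, Rabs_R0. lra. }
  assert (Hcl0 : cl 0 = 0).
  { unfold cl, Rmax, Rmin. repeat destruct (Rle_dec _ _); lra. }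
  assert (Hcl11 : cl 1 = 1).
  { unfold cl, Rmax, Rmin. repeat destruct (Rle_dec _ _); lra. }
  assert (Hg0 : g 0 = 1).
  { unfold g. destruct (excluded_middle_informative _) as [v|v]; [reflexivity|].
    exfalso. apply v. rewrite Hcl0. exists rho. split; [exact Hrho|].
    intros h Hh. replace (RtoC 0 * z + h)%C with h by ring. apply H0, Hh. }
  assert (Hg1 : g 1 = 1).
  { unfold g at 1. destruct (excluded_middle_informative _) as [v|v]; [reflexivity|].
    exfalso. assert (E : g 1 = -1).
    { unfold g. destruct (excluded_middle_informative _); [contradiction|reflexivity]. }
    destruct (IVT_gen g 0 1 0 Hcont) as (t & _ & Ht).
    - rewrite Hg0, E. unfold Rmin, Rmax. repeat destruct (Rle_dec _ _); lra.
    - unfold g in Ht. destruct (excluded_middle_informative _); lra. }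
  unfold g in Hg1. destruct (excluded_middle_informative _) as [(e & He & v)|v]; [|lra].
  rewrite Hcl11 in v. specialize (v (RtoC 0)). rewrite Cmod_0 in v.
  rewrite <- (v He). f_equal. ring.
Qed.

(** Applied to each [z - phi_j(z)], this yields points near the origin that are fixed by none of the
    maps. *)
Lemma analytic_punctured_nonzero (f : C -> C) :
  analytic_on_disk f -> ~ (forall z, disk z -> f z = RtoC 0) ->
  exists rho, 0 < rho /\
    forall z, z <> RtoC 0 -> Cmod z < rho -> f z <> RtoC 0.
Proof.
  intros Hf Hn.
  assert (Hd : disk (RtoC 0)) by (unfold disk; rewrite Cmod_0; lra).
  destruct (analytic_isolated_zeros f _ Hf Hd) as (rho & Hrho & [H|H]).
  - exfalso. apply Hn. intros z Hz. apply (analytic_identity f z rho Hf Hz Hrho).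
    intros h Hh. rewrite <- (H h Hh). f_equal. ring.
  - exists rho. split; [exact Hrho|]. intros z Hz Hlt.
    replace z with (RtoC 0 + z)%C by ring. apply H; assumption.
Qed.

(** * Maximum modulus *)

(** A second-order expansion suffices to exclude local maxima, and its stability under products is
    elementary, without Cauchy products of power series. *)
Definition quadratic_at (f : C -> C) (z0 : C) : Prop :=
  exists (a b c : C) (K rho : R), 0 < rho /\ 0 <= K /\
    forall h, Cmod h <= rho ->
      Cmod (f (z0 + h) - (a + b * h + c * (h * h)))%C <= K * Cmod h ^ 3.

Lemma analytic_quadratic_at (f : C -> C) (z0 : C) :
  analytic_on_disk f -> disk z0 -> quadratic_at f z0.
Proof.
  intros Hf Hz. destruct (analytic_taylor_at f z0 Hf Hz) as (a & A & B & HA & HB & H).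
  exists (a 0%nat), (a 1%nat), (a 2%nat), (B * A ^ 3), (/ (2 * A)).
  split; [apply Rinv_0_lt_compat; lra|]. split.
  { apply Rmult_le_pos; [lra|apply pow_le; lra]. }
  intros h Hh.
  assert (HAs : A * / (2 * A) = / 2) by (field; lra).
  specialize (H 3%nat h ltac:(nra)). simpl csum in H.
  replace (B * A ^ 3 * Cmod h ^ 3) with (B * (A * Cmod h) ^ 3) by ring.
  eapply Rle_trans; [|exact H]. right. f_equal. ring.
Qed.

Lemma quadratic_at_const (c z0 : C) : quadratic_at (fun _ => c) z0.
Proof.
  exists c, (RtoC 0), (RtoC 0), 0, 1. split; [lra|]. split; [lra|].
  intros h _. replace (_ - _)%C with (RtoC 0) by ring. rewrite Cmod_0. lra.
Qed.

Lemma Cmod_quadratic_le (a b c h : C) :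
  Cmod h <= 1 -> Cmod (a + b * h + c * (h * h))%C <= Cmod a + Cmod b + Cmod c.
Proof.
  intros Hh. pose proof (Cmod_ge_0 h). pose proof (Cmod_ge_0 b). pose proof (Cmod_ge_0 c).
  eapply Rle_trans; [apply Cmod_triangle|].
  eapply Rle_trans; [apply Rplus_le_compat_r, Cmod_triangle|]. rewrite !Cmod_mult.
  assert (Cmod h * Cmod h <= 1) by nra. nra.
Qed.

(** With expansions [P] and [P'], the error is [f (g - P') + (f - P) P'] plus the terms of [P P'] of
    degree 3 and 4. [Q] bounds the latter after division by [h^3], using [|h| <= 1]. *)
Lemma quadratic_at_mult (f g : C -> C) (z0 : C) :
  quadratic_at f z0 -> quadratic_at g z0 -> quadratic_at (fun z => (f z * g z)%C) z0.
Proof.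
  intros (a & b & c & K & rho & Hrho & HK & H) (a' & b' & c' & K' & rho' & Hrho' & HK' & H').
  set (T := Cmod a + Cmod b + Cmod c). set (T' := Cmod a' + Cmod b' + Cmod c').
  set (Q := Cmod (b * c' + c * b')%C + Cmod (c * c')%C).
  assert (HT : 0 <= T) by (unfold T; pose proof (Cmod_ge_0 a);
    pose proof (Cmod_ge_0 b); pose proof (Cmod_ge_0 c); lra).
  assert (HT' : 0 <= T') by (unfold T'; pose proof (Cmod_ge_0 a');
    pose proof (Cmod_ge_0 b'); pose proof (Cmod_ge_0 c'); lra).
  assert (HQ : 0 <= Q) by (unfold Q; pose proof (Cmod_ge_0 (b * c' + c * b')%C);
    pose proof (Cmod_ge_0 (c * c')%C); lra).
  exists (a * a')%C, (a * b' + b * a')%C, (a * c' + b * b' + c * a')%C,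
    ((T + K) * K' + K * T' + Q), (Rmin 1 (Rmin rho rho')).
  split; [repeat apply Rmin_pos; lra|]. split; [nra|]. intros h Hh.
  pose proof (Rmin_l 1 (Rmin rho rho')). pose proof (Rmin_r 1 (Rmin rho rho')).
  pose proof (Rmin_l rho rho'). pose proof (Rmin_r rho rho').
  assert (Hh1 : Cmod h <= 1) by lra.
  specialize (H h ltac:(lra)). specialize (H' h ltac:(lra)).
  pose proof (Cmod_quadratic_le a b c h Hh1) as HP. fold T in HP.
  pose proof (Cmod_quadratic_le a' b' c' h Hh1) as HP'. fold T' in HP'.
  set (P := (a + b * h + c * (h * h))%C) in *.
  set (P' := (a' + b' * h + c' * (h * h))%C) in *.
  set (t := Cmod h ^ 3) in *.
  assert (Ht : 0 <= t <= 1).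
  { unfold t. pose proof (Cmod_ge_0 h). split; [apply pow_le; lra|].
    rewrite <- (pow1 3). apply pow_incr. lra. }
  assert (Hfb : Cmod (f (z0 + h)%C) <= T + K).
  { replace (f (z0 + h)%C) with ((f (z0 + h) - P) + P)%C by ring.
    eapply Rle_trans; [apply Cmod_triangle|]. nra. }
  match goal with |- Cmod ?x <= _ =>
    replace x with (f (z0 + h) * (g (z0 + h) - P') + (f (z0 + h) - P) * P'
      + h * (h * h) * (b * c' + c * b' + c * c' * h))%C by (unfold P, P'; ring) end.
  eapply Rle_trans; [apply Cmod_triangle|].
  eapply Rle_trans; [apply Rplus_le_compat_r, Cmod_triangle|].
  rewrite (Cmod_mult (f _)), (Cmod_mult (_ - P)%C), (Cmod_mult (h * (h * h))%C).
  assert (HQ' : Cmod (b * c' + c * b' + c * c' * h)%C <= Q).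
  { eapply Rle_trans; [apply Cmod_triangle|]. unfold Q. apply Rplus_le_compat_l.
    rewrite Cmod_mult. pose proof (Cmod_ge_0 (c * c')%C). nra. }
  replace (Cmod (h * (h * h))%C) with t by (unfold t; rewrite !Cmod_mult; ring).
  assert (Cmod (f (z0 + h)%C) * Cmod (g (z0 + h) - P')%C <= (T + K) * (K' * t)).
  { apply Rmult_le_compat; auto using Cmod_ge_0. }
  assert (Cmod (f (z0 + h) - P)%C * Cmod P' <= (K * t) * T').
  { apply Rmult_le_compat; auto using Cmod_ge_0. }
  nra.
Qed.

Lemma quadratic_expansion_value (f : C -> C) (z0 a b c : C) (K r : R) :
  0 < r ->
  (forall h, Cmod h <= r ->
    Cmod (f (z0 + h) - (a + b * h + c * (h * h)))%C <= K * Cmod h ^ 3) ->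
  f z0 = a.
Proof.
  intros Hr H. specialize (H (RtoC 0)). rewrite Cmod_0 in H. specialize (H ltac:(lra)).
  replace (z0 + RtoC 0)%C with z0 in H by ring.
  replace (f z0 - (a + b * RtoC 0 + c * (RtoC 0 * RtoC 0)))%C
    with (f z0 - a)%C in H by ring.
  assert (E : Cmod (f z0 - a)%C = 0) by (pose proof (Cmod_ge_0 (f z0 - a)%C); simpl in H; lra).
  apply Cmod_eq_0 in E.
  replace (f z0) with ((f z0 - a) + a)%C by ring. rewrite E. ring.
Qed.

(** A discrete Parseval identity: [1], [h], [h^2] are orthogonal on the four points [t i^k]. *)
Lemma quadratic_four_points (a b c : C) (t : R) :
  let q := fun h => Cmod (a + b * h + c * (h * h))%C ^ 2 in
  q (RtoC t) + q (RtoC t * Ci)%C + q (- RtoC t)%C + q (- (RtoC t * Ci))%C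
  = 4 * (Cmod a ^ 2 + Cmod b ^ 2 * t ^ 2 + Cmod c ^ 2 * t ^ 4).
Proof.
  intros q. unfold q. rewrite !Cmod2_alt.
  destruct a, b, c. unfold Ci, RtoC, Copp, Cplus, Cmult, Re, Im. simpl. ring.
Qed.

(** If [|x - y| <= |y|], square the reverse triangle inequality; otherwise the left side is not
    positive. *)
Lemma Cmod_sqr_perturb (x y : C) : Cmod y ^ 2 - 2 * Cmod y * Cmod (x - y)%C <= Cmod x ^ 2.
Proof.
  assert (Cmod y <= Cmod x + Cmod (x - y)%C).
  { replace y with (x + - (x - y))%C at 1 by ring.
    eapply Rle_trans; [apply Cmod_triangle|]. rewrite Cmod_opp. lra. }
  pose proof (Cmod_ge_0 x). pose proof (Cmod_ge_0 y). pose proof (Cmod_ge_0 (x - y)%C).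
  destruct (Rle_dec (Cmod (x - y)%C) (Cmod y)); nra.
Qed.

(* Averaging over [t, it, -t, -it] kills the terms of order one and two of the
   expansion of [f] exactly, and [eta |z|^2] gains [eta t^2]. *)
Lemma quadratic_at_no_local_max (f : C -> C) (z0 : C) (eta rho : R) :
  quadratic_at f z0 -> 0 < eta -> 0 < rho ->
  exists h, Cmod h < rho /\
    Cmod (f z0) ^ 2 + eta * Cmod z0 ^ 2
    < Cmod (f (z0 + h)%C) ^ 2 + eta * Cmod (z0 + h)%C ^ 2.
Proof.
  intros (a & b & c & K & r & Hr & HK & H) Heta Hrho.
  set (T := Cmod a + Cmod b + Cmod c).
  assert (HT : 0 <= T) by (unfold T; pose proof (Cmod_ge_0 a);
    pose proof (Cmod_ge_0 b); pose proof (Cmod_ge_0 c); lra).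
  assert (HTK : 0 <= T * K) by nra.
  pose proof (quadratic_expansion_value f z0 a b c K r Hr H) as Ha.
  (* Chosen so that [t < e] contradicts [eta <= 2 T K t], the inequality reached at the end. *)
  set (e := eta / (2 * T * K + 1)).
  assert (He : 0 < e) by (apply Rdiv_lt_0_compat; lra).
  assert (Hee : e * (2 * T * K + 1) = eta) by (unfold e; field; nra).
  set (t := Rmin (Rmin 1 r) (Rmin rho e) / 2).
  assert (Ht0 : 0 < Rmin (Rmin 1 r) (Rmin rho e)) by (repeat apply Rmin_pos; lra).
  pose proof (Rmin_l (Rmin 1 r) (Rmin rho e)). pose proof (Rmin_r (Rmin 1 r) (Rmin rho e)).
  pose proof (Rmin_l 1 r). pose proof (Rmin_r 1 r).
  pose proof (Rmin_l rho e). pose proof (Rmin_r rho e).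
  assert (Ht : 0 < t /\ t < 1 /\ t < r /\ t < rho /\ t < e) by (unfold t; lra).
  clearbody t. destruct Ht as (Htp & Ht1 & Htr & Htrho & Hte).
  set (q := fun h => Cmod (a + b * h + c * (h * h))%C ^ 2).
  assert (Hh : forall h, Cmod h = t ->
    q h - 2 * T * K * t ^ 3 <= Cmod (f (z0 + h)%C) ^ 2).
  { intros h Eh. specialize (H h ltac:(lra)). rewrite Eh in H.
    pose proof (Cmod_quadratic_le a b c h ltac:(lra)) as HP. fold T in HP.
    pose proof (Cmod_sqr_perturb (f (z0 + h)%C) (a + b * h + c * (h * h))%C) as Hp.
    unfold q. eapply Rle_trans; [|exact Hp]. apply Rplus_le_compat_l, Ropp_le_contravar.
    replace (2 * T * K * t ^ 3) with (2 * T * (K * t ^ 3)) by ring.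
    rewrite !(Rmult_assoc 2). apply Rmult_le_compat_l; [lra|].
    apply Rmult_le_compat; auto using Cmod_ge_0. }
  apply NNPP. intros Hno.
  assert (Hle : forall h, Cmod h = t -> Cmod (f (z0 + h)%C) ^ 2 + eta * Cmod (z0 + h)%C ^ 2
    <= Cmod a ^ 2 + eta * Cmod z0 ^ 2).
  { intros h Eh. apply Rnot_lt_le. intros Hlt. apply Hno. exists h.
    split; [lra|]. rewrite Ha. exact Hlt. }
  assert (E1 : Cmod (RtoC t) = t) by (rewrite Cmod_R, Rabs_pos_eq; lra).
  assert (E2 : Cmod (RtoC t * Ci)%C = t) by (rewrite Cmod_mult, Cmod_Ci, E1; lra).
  assert (E3 : Cmod (- RtoC t)%C = t) by (rewrite Cmod_opp; exact E1).
  assert (E4 : Cmod (- (RtoC t * Ci))%C = t) by (rewrite Cmod_opp; exact E2).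
  pose proof (quadratic_four_points a b c t) as Hq. cbv beta zeta in Hq.
  (* The same identity for the polynomial [z0 + h] evaluates the sum of [|z0 + h|^2]; this is the
     source of the gain [t^2]. *)
  pose proof (quadratic_four_points z0 (RtoC 1) (RtoC 0) t) as Hz. cbv beta zeta in Hz.
  assert (Ez : forall h, (z0 + RtoC 1 * h + RtoC 0 * (h * h))%C = (z0 + h)%C)
    by (intros; ring).
  rewrite !Ez, Cmod_0, Cmod_1 in Hz.
  pose proof (Hh _ E1). pose proof (Hh _ E2). pose proof (Hh _ E3). pose proof (Hh _ E4).
  pose proof (Hle _ E1). pose proof (Hle _ E2). pose proof (Hle _ E3). pose proof (Hle _ E4).
  unfold q in *.
  assert (0 <= Cmod b ^ 2 * t ^ 2) by (apply Rmult_le_pos; apply pow2_ge_0).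
  assert (0 <= Cmod c ^ 2 * t ^ 4).
  { apply Rmult_le_pos; [apply pow2_ge_0|apply pow_le; lra]. }
  assert (Hfin : 4 * eta * t ^ 2 <= 8 * T * K * t ^ 3) by (simpl (0 ^ 2) in Hz; nra).
  assert (eta <= 2 * T * K * t).
  { apply (Rmult_le_reg_r (4 * t ^ 2)); [nra|].
    replace (2 * T * K * t * (4 * t ^ 2)) with (8 * T * K * t ^ 3) by ring. lra. }
  nra.
Qed.

(** Upper semicontinuity of [|f|^2 + eta |z|^2]: it spreads a strict upper bound at a point, with a
    margin, over a neighbourhood. *)
Lemma quadratic_at_continuous (f : C -> C) (z0 : C) (eta e : R) :
  quadratic_at f z0 -> 0 <= eta -> 0 < e ->
  exists rho, 0 < rho /\ forall h, Cmod h < rho ->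
    Cmod (f (z0 + h)%C) ^ 2 + eta * Cmod (z0 + h)%C ^ 2
    <= Cmod (f z0) ^ 2 + eta * Cmod z0 ^ 2 + e.
Proof.
  intros (a & b & c & K & r & Hr & HK & H) Heta He.
  pose proof (quadratic_expansion_value f z0 a b c K r Hr H) as Ha.
  set (L := Cmod b + Cmod c + K).
  assert (HL : 0 <= L) by (unfold L; pose proof (Cmod_ge_0 b); pose proof (Cmod_ge_0 c); lra).
  pose proof (Cmod_ge_0 a) as Hap. pose proof (Cmod_ge_0 z0) as Hzp.
  set (D := 2 * Cmod a * L + L ^ 2 + eta * (2 * Cmod z0 + 1) + 1).
  assert (HD : 0 < D) by (unfold D; nra).
  assert (HeD : 0 < e / D) by (apply Rdiv_lt_0_compat; lra).
  assert (HeD' : e / D * D = e) by (field; lra).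
  exists (Rmin 1 (Rmin r (e / D))). split; [repeat apply Rmin_pos; lra|].
  intros h Hh. pose proof (Rmin_l 1 (Rmin r (e / D))). pose proof (Rmin_r 1 (Rmin r (e / D))).
  pose proof (Rmin_l r (e / D)). pose proof (Rmin_r r (e / D)).
  specialize (H h ltac:(lra)). set (t := Cmod h) in *.
  assert (Ht : 0 <= t) by apply Cmod_ge_0.
  assert (Ht1 : t <= 1) by lra.
  assert (Hf : Cmod (f (z0 + h)%C) <= Cmod a + L * t).
  { replace (f (z0 + h)%C) with
      ((f (z0 + h) - (a + b * h + c * (h * h))) + (a + b * h + c * (h * h)))%C by ring.
    eapply Rle_trans; [apply Cmod_triangle|].
    assert (Cmod (a + b * h + c * (h * h))%C <= Cmod a + Cmod b * t + Cmod c * (t * t)).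
    { eapply Rle_trans; [apply Cmod_triangle|].
      eapply Rle_trans; [apply Rplus_le_compat_r, Cmod_triangle|].
      rewrite !Cmod_mult. unfold t. lra. }
    assert (Cmod c * (t * t) <= Cmod c * t).
    { apply Rmult_le_compat_l; [apply Cmod_ge_0|nra]. }
    assert (K * t ^ 3 <= K * t) by (apply Rmult_le_compat_l; [lra|]; simpl; nra).
    unfold L. lra. }
  assert (Hz : Cmod (z0 + h)%C <= Cmod z0 + t) by apply Cmod_triangle.
  rewrite Ha.
  assert (Cmod (f (z0 + h)%C) ^ 2 <= (Cmod a + L * t) ^ 2).
  { apply pow_incr. split; [apply Cmod_ge_0|exact Hf]. }
  assert (Cmod (z0 + h)%C ^ 2 <= (Cmod z0 + t) ^ 2).
  { apply pow_incr. split; [apply Cmod_ge_0|exact Hz]. }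
  assert (t * D <= e) by (rewrite <- HeD'; apply Rmult_le_compat_r; lra).
  assert ((Cmod a + L * t) ^ 2 <= Cmod a ^ 2 + t * (2 * Cmod a * L + L ^ 2)).
  { assert (0 <= L ^ 2 * (t * (1 - t))) by (apply Rmult_le_pos; [apply pow2_ge_0|nra]). nra. }
  assert (eta * Cmod (z0 + h)%C ^ 2 <= eta * (Cmod z0 ^ 2 + t * (2 * Cmod z0 + 1))).
  { apply Rmult_le_compat_l; [exact Heta|]. nra. }
  unfold D in *. nra.
Qed.

(** Let [m] be the supremum of [g = |f|^2 + eta |w|^2] on the closed disk, finite because of [B]. If
    [|f(z)|^2 > M^2 + eta r^2], then [m] is attained neither inside, where [g] has no local maximum,
    nor on the circle. Compactness then puts [g] uniformly below [m], a contradiction; finally [eta]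
    is made small. *)
Lemma max_modulus (f : C -> C) (r M B : R) :
  0 < r -> 0 <= M ->
  (forall z, Cmod z <= r -> quadratic_at f z) ->
  (forall z, Cmod z <= r -> Cmod (f z) <= B) ->
  (forall z, Cmod z = r -> Cmod (f z) <= M) ->
  forall z, Cmod z <= r -> Cmod (f z) <= M.
Proof.
  intros Hr HM Hq HB Hbd z Hz.
  assert (Hmain : forall eta, 0 < eta -> Cmod (f z) ^ 2 <= M ^ 2 + eta * r ^ 2).
  { intros eta Heta. set (g := fun w => Cmod (f w) ^ 2 + eta * Cmod w ^ 2).
    assert (Hgz : Cmod (f z) ^ 2 <= g z).
    { unfold g. pose proof (pow2_ge_0 (Cmod z)). nra. }
    apply Rnot_lt_le. intros Hlt.
    destruct (completeness (fun x => exists w, Cmod w <= r /\ x = g w)) as [m [Hub Hlub]].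
    { exists (B ^ 2 + eta * r ^ 2). intros x (w & Hw & ->). unfold g.
      apply Rplus_le_compat.
      - apply pow_incr. split; [apply Cmod_ge_0|apply HB, Hw].
      - apply Rmult_le_compat_l; [lra|]. apply pow_incr. split; [apply Cmod_ge_0|exact Hw]. }
    { exists (g z), z. split; [exact Hz|reflexivity]. }
    assert (Hgm : forall w, Cmod w <= r -> g w <= m).
    { intros w Hw. apply Hub. exists w. split; [exact Hw|reflexivity]. }
    assert (Hstrict : forall w, Cmod w <= r -> g w < m).
    { intros w Hw. destruct (Rle_lt_or_eq_dec _ _ (Hgm w Hw)) as [|E]; [assumption|].
      destruct (Rle_lt_or_eq_dec _ _ Hw) as [Hwr|Hwr].
      - destruct (quadratic_at_no_local_max f w eta (r - Cmod w) (Hq w Hw) Heta ltac:(lra))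
          as (h & Hh & Hgt).
        assert (Cmod (w + h)%C <= r) as Hwh.
        { eapply Rle_trans; [apply Cmod_triangle|]. lra. }
        pose proof (Hgm _ Hwh) as Hc. unfold g in Hc, E. lra.
      - exfalso. pose proof (Hgm z Hz). unfold g in E at 1. rewrite Hwr in E.
        assert (Cmod (f w) ^ 2 <= M ^ 2).
        { apply pow_incr. split; [apply Cmod_ge_0|apply Hbd, Hwr]. }
        lra. }
    (* One number [d] serves both as the size of the square and as the margin below [m]. Around a
       centre outside the closed disk, the square is small enough to miss the disk. *)
    assert (Hdelta : forall u v : R, exists d : posreal, forall x y,
      Rabs (x - u) < d -> Rabs (y - v) < d -> Cmod (x, y) <= r -> g (x, y) <= m - d).
    { intros u v.
      assert (Hsq : forall x y e, Rabs (x - u) < e / 2 -> Rabs (y - v) < e / 2 ->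
        exists h, Cmod h < e /\ (x, y) = ((u, v) + h)%C).
      { intros x y e Hx Hy. exists (x - u, y - v). split.
        - replace ((x - u, y - v) : C) with (RtoC (x - u) + RtoC (y - v) * Ci)%C
            by (unfold RtoC, Ci, Cplus, Cmult; simpl; f_equal; ring).
          eapply Rle_lt_trans; [apply Cmod_triangle|].
          rewrite Cmod_mult, Cmod_Ci, !Cmod_R. lra.
        - unfold Cplus. simpl. f_equal; ring. }
      destruct (Rle_lt_dec (Cmod (u, v)) r) as [Hin|Hout].
      - pose proof (Hstrict _ Hin) as Hs.
        destruct (quadratic_at_continuous f (u, v) eta ((m - g (u, v)) / 2)
          (Hq _ Hin) ltac:(lra) ltac:(lra)) as (rho & Hrho & Hc).
        assert (Hd : 0 < Rmin (rho / 2) ((m - g (u, v)) / 2)) by (apply Rmin_pos; lra).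
        exists (mkposreal _ Hd). simpl. intros x y Hx Hy _.
        pose proof (Rmin_l (rho / 2) ((m - g (u, v)) / 2)).
        pose proof (Rmin_r (rho / 2) ((m - g (u, v)) / 2)).
        destruct (Hsq x y rho ltac:(lra) ltac:(lra)) as (h & Hh & ->).
        specialize (Hc h Hh). unfold g in *. lra.
      - assert (Hd : 0 < (Cmod (u, v) - r) / 2) by lra.
        exists (mkposreal _ Hd). simpl. intros x y Hx Hy Hxy. exfalso.
        destruct (Hsq x y _ Hx Hy) as (h & Hh & E). rewrite E in Hxy.
        assert (Cmod (u, v) <= Cmod ((u, v) + h)%C + Cmod h); [|lra].
        replace ((u, v) : C) with (((u, v) + h) + - h)%C at 1 by ring.
        eapply Rle_trans; [apply Cmod_triangle|]. rewrite Cmod_opp. lra. }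
    set (dl := fun u v => proj1_sig (constructive_indefinite_description _ (Hdelta u v))).
    assert (Hdl : forall u v x y, Rabs (x - u) < dl u v -> Rabs (y - v) < dl u v ->
      Cmod (x, y) <= r -> g (x, y) <= m - dl u v).
    { intros u v. unfold dl. apply proj2_sig. }
    destruct (compactness_value_2d (- r) r (- r) r dl) as [d Hd].
    assert (m <= m - d); [|pose proof (cond_pos d); lra].
    apply Hlub. intros s ([x y] & Hw & ->).
    pose proof (Rmax_Cmod (x, y)) as Hxy. simpl in Hxy.
    pose proof (Rmax_l (Rabs x) (Rabs y)). pose proof (Rmax_r (Rabs x) (Rabs y)). apply Rnot_lt_le. intros Hgt.
    (* Compactness provides the nearby centre only under a double negation, which is usable since
       the goal is now a contradiction. *)
    apply (Hd x y).
    - apply Rabs_le_between. lra.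
    - apply Rabs_le_between. lra.
    - intros (u & v & _ & _ & Hx & Hy & Hdd).
      specialize (Hdl u v x y Hx Hy Hw). lra. }
  apply Rnot_lt_le. intros Hlt.
  assert (M ^ 2 < Cmod (f z) ^ 2) by nra.
  (* With this [eta], the perturbation [eta r^2] is half of the supposed gap. *)
  specialize (Hmain ((Cmod (f z) ^ 2 - M ^ 2) / (2 * r ^ 2))).
  assert (0 < r ^ 2) by (apply pow_lt; exact Hr).
  specialize (Hmain ltac:(apply Rdiv_lt_0_compat; lra)).
  replace ((Cmod (f z) ^ 2 - M ^ 2) / (2 * r ^ 2) * r ^ 2)
    with ((Cmod (f z) ^ 2 - M ^ 2) / 2) in Hmain by (field; lra).
  lra.
Qed.

Lemma analytic_id_minus_scal (f : C -> C) (s : C) :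
  analytic_on_disk f -> analytic_on_disk (fun z => (z - s * f z)%C).
Proof.
  intros Hf z0 Hz. destruct (Hf z0 Hz) as (r & a & Hr & Ha).
  set (b := fun k : nat => match k with O => z0 | 1%nat => RtoC 1 | _ => RtoC 0 end).
  exists r, (fun k => (b k + - s * a k)%C). split; [exact Hr|]. intros z Hzr.
  specialize (Ha z Hzr). apply is_pseries_C, is_series_Cmod.
  apply is_pseries_C in Ha. intros e He.
  pose proof (Cmod_ge_0 s) as Hs.
  destruct (proj1 (is_series_Cmod _ _) Ha (e / (Cmod s + 1))) as [N HN].
  { apply Rdiv_lt_0_compat; lra. }
  (* The partial sums of the identity, [z0 + (z - z0)], are exact from two terms on. *)
  exists (N + 2)%nat. intros m Hm. specialize (HN m ltac:(lia)).
  assert (Hb : csum (fun k => b k * (z - z0) ^ k)%C m = z).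
  { destruct m as [|[|m]]; [lia|lia|]. clear. induction m as [|m IH].
    - simpl. ring.
    - change (csum (fun k => b k * (z - z0) ^ k) (S (S m))
        + b (S (S m)) * (z - z0) ^ S (S m) = z)%C. rewrite IH. simpl b. ring. }
  rewrite (csum_ext _ (fun k => b k * (z - z0) ^ k + - s * (a k * (z - z0) ^ k))%C)
    by (intros; ring).
  rewrite csum_plus, csum_scal, Hb.
  match goal with |- Cmod ?x < _ =>
    replace x with (- s * (csum (fun k => a k * (z - z0) ^ k) m - f z))%C by ring end.
  rewrite Cmod_mult, Cmod_opp.
  apply (Rmult_lt_compat_l (Cmod s + 1)) in HN; [|lra].
  replace ((Cmod s + 1) * (e / (Cmod s + 1))) with e in HN by (field; lra).
  pose proof (Cmod_ge_0 (csum (fun k => a k * (z - z0) ^ k) m - f z)%C). nra.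
Qed.

(** * Interpolation of the resolvent *)

Fixpoint cprod (u : nat -> C) (m : nat) : C :=
  match m with O => RtoC 1 | S k => (cprod u k * u k)%C end.

Lemma cprod_zero (u : nat -> C) (m j : nat) :
  (j < m)%nat -> u j = RtoC 0 -> cprod u m = RtoC 0.
Proof.
  induction m as [|m IH]; intros Hj H; [lia|]. simpl.
  destruct (Nat.eq_dec j m) as [<-|]; [rewrite H|rewrite IH by (assumption || lia)]; ring.
Qed.

Lemma Cmod_cprod_le (u : nat -> C) (m : nat) (b : R) :
  (forall j, (j < m)%nat -> Cmod (u j) <= b) -> Cmod (cprod u m) <= b ^ m.
Proof.
  induction m as [|m IH]; intros H; simpl; [rewrite Cmod_1; lra|].
  rewrite Cmod_mult, Rmult_comm. apply Rmult_le_compat; try apply Cmod_ge_0.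
  - apply H. lia.
  - apply IH. intros. apply H. lia.
Qed.

Lemma Cmod_cprod_ge (u : nat -> C) (m : nat) (b : R) :
  0 <= b -> (forall j, (j < m)%nat -> b <= Cmod (u j)) -> b ^ m <= Cmod (cprod u m).
Proof.
  induction m as [|m IH]; intros Hb H; simpl; [rewrite Cmod_1; lra|].
  rewrite Cmod_mult, (Rmult_comm (Cmod _)).
  apply Rmult_le_compat; [exact Hb|apply pow_le, Hb| |].
  - apply H. lia.
  - apply IH; [exact Hb|]. intros. apply H. lia.
Qed.

Lemma cprod_quadratic_at (g : nat -> C -> C) (m : nat) (z0 : C) :
  (forall j, (j < m)%nat -> quadratic_at (g j) z0) ->
  quadratic_at (fun z => cprod (fun j => g j z) m) z0.
Proof.
  induction m as [|m IH]; intros H; simpl.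
  - apply quadratic_at_const.
  - apply (quadratic_at_mult (fun z => cprod (fun j => g j z) m)).
    + apply IH. intros. apply H. lia.
    + apply H. lia.
Qed.

(* [t |-> resolvent_interp u s x m t] is a polynomial of degree less than [m]
   equal to [cprod (u - s x_j) / (u - s t)] at every node [x_j], including
   repeated ones. *)
Fixpoint resolvent_interp (u s : C) (x : nat -> C) (m : nat) (t : C) : C :=
  match m with
  | O => RtoC 0
  | S k => (cprod (fun j => u - s * x j) k
            + s * (t - x k) * resolvent_interp u s x k t)%C
  end.

(** The last product vanishes when [t] is a node, which gives the interpolation property without any
    division or distinctness of nodes. *)
Lemma resolvent_interp_eq (u s : C) (x : nat -> C) (m : nat) (t : C) :
  ((u - s * t) * resolvent_interp u s x m t
   = cprod (fun j => u - s * x j) m - cprod (fun j => s * (t - x j)) m)%C.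
Proof.
  induction m as [|m IH]; simpl; [ring|].
  transitivity ((u - s * t) * cprod (fun j => u - s * x j) m
    + s * (t - x m) * ((u - s * t) * resolvent_interp u s x m t))%C; [ring|].
  rewrite IH. ring.
Qed.

(** The factor [t - x_m] of the recursion raises the power of [t], so the induction carries an
    arbitrary [t^k] with [m + k <= n]. Each step produces three contributions, each at most
    [3^m H]. *)
Lemma resolvent_interp_moment (u s : C) (x y : nat -> C) (n m k : nat) (H : R) :
  Cmod u <= 1 -> Cmod s <= 1 -> (forall j, (j < n)%nat -> Cmod (x j) <= 1) ->
  (forall i, (i <= n)%nat -> Cmod (csum (fun j => y j * x j ^ i) n)%C <= H) ->
  (m + k <= n)%nat ->
  Cmod (csum (fun j => y j * (x j ^ k * resolvent_interp u s x m (x j))) n)%C <= 3 ^ m * H.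
Proof.
  intros Hu Hs Hx HH. revert k. induction m as [|m IH]; intros k Hk.
  - simpl. rewrite csum_zero by (intros; ring). rewrite Cmod_0.
    pose proof (HH 0%nat ltac:(lia)). pose proof (Cmod_ge_0 (csum (fun j => y j * x j ^ 0) n)%C).
    lra.
  - set (A := cprod (fun j => u - s * x j)%C m).
    simpl resolvent_interp. fold A.
    rewrite (csum_ext _ (fun j => A * (y j * x j ^ k)
      + (s * (y j * (x j ^ S k * resolvent_interp u s x m (x j)))
         + (- (s * x m)) * (y j * (x j ^ k * resolvent_interp u s x m (x j)))))%C)
      by (intros; simpl; ring).
    rewrite !csum_plus, !csum_scal.
    pose proof (IH k ltac:(lia)) as I1. pose proof (IH (S k) ltac:(lia)) as I2.
    pose proof (HH k ltac:(lia)) as I3.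
    eapply Rle_trans; [apply Cmod_triangle|].
    eapply Rle_trans; [apply Rplus_le_compat_l, Cmod_triangle|].
    rewrite !Cmod_mult, Cmod_opp, Cmod_mult.
    set (q1 := Cmod (csum (fun j => y j * x j ^ k) n)%C) in *.
    set (q2 := Cmod (csum (fun j => y j * (x j ^ S k * resolvent_interp u s x m (x j))) n)%C) in *.
    set (q3 := Cmod (csum (fun j => y j * (x j ^ k * resolvent_interp u s x m (x j))) n)%C) in *.
    assert (Hq : 0 <= q1 /\ 0 <= q2 /\ 0 <= q3) by (repeat split; apply Cmod_ge_0).
    assert (Hxm : Cmod (x m) <= 1) by (apply Hx; lia).
    pose proof (Cmod_ge_0 s). pose proof (Cmod_ge_0 (x m)).
    assert (HA : Cmod A <= 3 ^ m).
    { apply Rle_trans with (2 ^ m); [|apply pow_incr; lra].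
      apply Cmod_cprod_le. intros j Hj.
      eapply Rle_trans; [apply Cmod_triangle|]. rewrite Cmod_opp, Cmod_mult.
      pose proof (Hx j ltac:(lia)). pose proof (Cmod_ge_0 (x j)). nra. }
    assert (Cmod A * q1 <= 3 ^ m * H) by (apply Rmult_le_compat; (apply Cmod_ge_0 || lra)).
    assert (Cmod s * q2 <= 3 ^ m * H) by nra.
    assert (0 <= Cmod s * Cmod (x m) <= 1) by nra.
    assert (Cmod s * Cmod (x m) * q3 <= 3 ^ m * H) by nra.
    simpl. lra.
Qed.

(** At each node, the full product divided by [u - s x_j] is the interpolating polynomial, so only
    the moments of the [y_j] matter. For [y_j = psi_j(w)] and [x_j = phi_j(w)] these are the values
    at [w] of the images of the monomials. *)
Lemma resolvent_sum_bound (u s : C) (x y : nat -> C) (n : nat) (H : R) :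
  Cmod u <= 1 -> Cmod s <= 1 -> (forall j, (j < n)%nat -> Cmod (x j) <= 1) ->
  (forall j, (j < n)%nat -> (u - s * x j)%C <> RtoC 0) ->
  (forall i, (i <= n)%nat -> Cmod (csum (fun j => y j * x j ^ i) n)%C <= H) ->
  Cmod (cprod (fun j => u - s * x j) n)%C * Cmod (csum (fun j => y j / (u - s * x j)) n)%C
  <= 3 ^ n * H.
Proof.
  intros Hu Hs Hx Hne HH.
  rewrite <- Cmod_mult, <- csum_scal.
  rewrite (csum_ext _ (fun j => y j * (x j ^ 0 * resolvent_interp u s x n (x j)))%C).
  - apply resolvent_interp_moment; auto. lia.
  - intros j Hj. pose proof (resolvent_interp_eq u s x n (x j)) as E.
    rewrite (cprod_zero (fun i => s * (x j - x i))%C n j Hj) in E by ring.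
    simpl. specialize (Hne j Hj).
    replace (cprod (fun j => u - s * x j) n)%C
      with ((u - s * x j) * resolvent_interp u s x n (x j))%C by (rewrite E; ring).
    field. exact Hne.
Qed.

(** * The Szego kernel of H^2 *)

Lemma is_series_single {K : AbsRing} {V : NormedModule K} (N : nat) (v : V) :
  is_series (fun k => if Nat.eq_dec k N then v else zero) v.
Proof.
  set (u := fun k => if Nat.eq_dec k N then v else zero).
  assert (H0 : forall m, (m < N)%nat -> sum_n u m = zero).
  { induction m as [|m IH]; intros Hm.
    - rewrite sum_O. unfold u. destruct (Nat.eq_dec 0 N); [lia|reflexivity].
    - rewrite sum_Sn, IH by lia. unfold u. destruct (Nat.eq_dec (S m) N); [lia|].
      apply plus_zero_l. }
  assert (H1 : forall m, (N <= m)%nat -> sum_n u m = v).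
  { intros m Hm. induction Hm as [|m Hm IH].
    - destruct N as [|N].
      + rewrite sum_O. reflexivity.
      + rewrite sum_Sn, H0 by lia. unfold u. destruct (Nat.eq_dec (S N) (S N)); [|lia].
        apply plus_zero_l.
    - rewrite sum_Sn, IH. unfold u. destruct (Nat.eq_dec (S m) N); [lia|].
      apply plus_zero_r. }
  apply filterlim_ext_loc with (fun _ => v); [|apply filterlim_const].
  exists N. intros m Hm. symmetry. apply H1, Hm.
Qed.

Lemma hardy2_Cpow (N : nat) : hardy2 (fun z => (z ^ N)%C).
Proof.
  exists (fun k => if Nat.eq_dec k N then RtoC 1 else RtoC 0). split.
  - intros z _. apply is_pseries_C.
    eapply is_series_ext; [|apply (is_series_single (V := C_NormedModule) N (z ^ N)%C)].
    intros k. cbv beta. destruct (Nat.eq_dec k N) as [->|].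
    + change (z ^ N = 1 * z ^ N)%C. ring.
    + change (RtoC 0 = (0 * z ^ k)%C). ring.
  - exists 1. eapply is_series_ext; [|apply (is_series_single (V := R_NormedModule) N 1)].
    intros k. cbv beta. destruct (Nat.eq_dec k N).
    + rewrite Cmod_1. change (1 = 1 ^ 2). ring.
    + rewrite Cmod_0. change (0 = 0 ^ 2). ring.
Qed.

Lemma disk_defect_pos (w : C) : disk w -> 0 < 1 - Cmod w ^ 2.
Proof. unfold disk. pose proof (Cmod_ge_0 w). nra. Qed.

(** Termwise, [2 d |a_k| |w|^k <= |a_k|^2 + d^2 |w|^(2k)] with [d^2 = 1 - |w|^2] replaces
    Cauchy-Schwarz; summing gives [|f(w)| <= (S2 + 1) / (2 d)]. The constant stands on the left so
    that shrinking it keeps the bound, as [uniform_pos] requires. *)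
Lemma hardy2_growth (f : C -> C) :
  hardy2 f -> exists rho, 0 < rho /\ forall w, disk w ->
    rho * ((1 - Cmod w ^ 2) * Cmod (f w)) <= sqrt (1 - Cmod w ^ 2).
Proof.
  intros (a & Ha & S2 & HS).
  assert (Hpart : forall m, sum_n (fun k => Cmod (a k) ^ 2) m <= S2).
  { apply is_lim_seq_incr_compare; [exact HS|]. intros m. rewrite sum_Sn.
    unfold plus; simpl. pose proof (pow2_ge_0 (Cmod (a (S m)))). simpl in *. lra. }
  assert (HS0 : 0 <= S2).
  { apply Rle_trans with (2 := Hpart 0%nat). rewrite sum_O. apply pow2_ge_0. }
  exists (2 / (S2 + 1)). split; [apply Rdiv_lt_0_compat; lra|]. intros w Hw.
  pose proof (disk_defect_pos w Hw) as Hd. set (q := Cmod w ^ 2) in *.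
  set (d := sqrt (1 - q)).
  assert (Hdp : 0 < d) by (apply sqrt_lt_R0; lra).
  assert (Hdd : d * d = 1 - q) by (apply sqrt_sqrt; lra).
  assert (Hq : 0 <= q) by apply pow2_ge_0.
  assert (Hterm : forall k, d * d * Cmod (a k * w ^ k)%C
    <= (d * Cmod (a k) ^ 2 + d * (1 - q) * q ^ k) / 2).
  { intros k. rewrite Cmod_mult, Cmod_pow, <- Hdd.
    replace (q ^ k) with ((Cmod w ^ k) ^ 2) by (unfold q; rewrite <- !pow_mult; f_equal; lia).
    pose proof (pow2_ge_0 (Cmod (a k) - d * Cmod w ^ k)). nra. }
  assert (Hsum : forall m, d * d * Cmod (csum (fun k => a k * w ^ k) (S m))%C
    <= (d * sum_n (fun k => Cmod (a k) ^ 2) m + d * (1 - q ^ S m)) / 2).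
  { induction m as [|m IH].
    - rewrite sum_O. specialize (Hterm 0%nat).
      replace (csum (fun k => a k * w ^ k) 1)%C with (a 0%nat * w ^ 0)%C by (simpl; ring).
      rewrite pow_1. rewrite pow_O in Hterm. lra.
    - rewrite sum_Sn.
      change (plus (sum_n (fun k => Cmod (a k) ^ 2) m) (Cmod (a (S m)) ^ 2))
        with (sum_n (fun k => Cmod (a k) ^ 2) m + Cmod (a (S m)) ^ 2).
      specialize (Hterm (S m)).
      assert (Htri : Cmod (csum (fun k => a k * w ^ k) (S (S m)))%C <=
        Cmod (csum (fun k => a k * w ^ k) (S m))%C + Cmod (a (S m) * w ^ S m)%C)
        by apply Cmod_triangle.
      apply (Rmult_le_compat_l (d * d)) in Htri; [|nra].
      change (q ^ S (S m)) with (q * q ^ S m). lra. }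
  assert (Hf : Cmod (f w - csum (fun k => a k * w ^ k) 0)%C <= (S2 + 1) / (2 * d)).
  { apply is_series_Cmod_tail; [apply is_pseries_C, Ha, Hw|]. intros k.
    rewrite Nat.add_0_r. simpl (csum _ 0).
    apply (Rmult_le_reg_l (d * d)); [nra|].
    replace (d * d * ((S2 + 1) / (2 * d))) with (d * (S2 + 1) / 2) by (field; lra).
    replace (csum (fun k => a k * w ^ k) k - RtoC 0)%C
      with (csum (fun k => a k * w ^ k)%C k) by ring.
    destruct k as [|k].
    - simpl. rewrite Cmod_0. nra.
    - eapply Rle_trans; [apply Hsum|].
      pose proof (Hpart k). pose proof (pow_le q (S k) Hq). nra. }
  replace (f w - csum (fun k => a k * w ^ k) 0)%C with (f w) in Hf by (simpl; ring).
  fold d. rewrite <- Hdd.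
  apply (Rmult_le_compat_l (2 / (S2 + 1) * (d * d))) in Hf.
  - replace (2 / (S2 + 1) * (d * d) * ((S2 + 1) / (2 * d))) with d in Hf by (field; lra).
    lra.
  - apply Rmult_le_pos; [|nra]. left. apply Rdiv_lt_0_compat; lra.
Qed.

Lemma is_series_geom_C (q : C) :
  Cmod q < 1 ->
  is_series (K := C_AbsRing) (V := C_NormedModule) (fun k => (q ^ k)%C) (/ (1 - q))%C.
Proof.
  intros Hq.
  assert (Hne : (1 - q)%C <> RtoC 0).
  { intros E. assert (E1 : q = RtoC 1).
    { replace q with (RtoC 1 - (1 - q))%C by ring. rewrite E. ring. }
    rewrite E1, Cmod_1 in Hq. lra. }
  assert (Hc : 0 < Cmod (1 - q)%C) by (apply Cmod_gt_0; exact Hne).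
  apply is_series_Cmod. intros e He.
  destruct (pow_lt_1_zero (Cmod q)) with (y := e * Cmod (1 - q)%C) as [N HN].
  - rewrite Rabs_pos_eq by apply Cmod_ge_0. exact Hq.
  - nra.
  - exists N. intros m Hm. specialize (HN m Hm).
    rewrite Rabs_pos_eq in HN by (apply pow_le, Cmod_ge_0).
    assert (E : csum (fun k => q ^ k)%C m = ((1 - q ^ m) / (1 - q))%C).
    { clear -Hne. induction m as [|m IH]; simpl; [field; exact Hne|].
      rewrite IH. field. exact Hne. }
    rewrite E.
    replace ((1 - q ^ m) / (1 - q) - / (1 - q))%C with (- (q ^ m / (1 - q)))%C
      by (field; exact Hne).
    rewrite Cmod_opp, Cmod_div, Cmod_pow by exact Hne.
    apply (Rmult_lt_reg_r (Cmod (1 - q)%C)); [exact Hc|].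
    unfold Rdiv. rewrite Rmult_assoc, Rinv_l by lra. lra.
Qed.

Definition szego (w : C) (z : C) : C := (RtoC (sqrt (1 - Cmod w ^ 2)) / (1 - Cconj w * z))%C.

Lemma one_minus_conj_mult_neq_0 (w z : C) :
  disk w -> disk z -> (1 - Cconj w * z)%C <> RtoC 0.
Proof.
  unfold disk. intros Hw Hz E.
  assert (E1 : Cmod (Cconj w * z)%C = 1).
  { replace (Cconj w * z)%C with (RtoC 1 - (1 - Cconj w * z))%C by ring.
    rewrite E. replace (RtoC 1 - RtoC 0)%C with (RtoC 1) by ring. apply Cmod_1. }
  rewrite Cmod_mult, Cmod_conj in E1.
  pose proof (Cmod_ge_0 w). pose proof (Cmod_ge_0 z). nra.
Qed.

Lemma szego_taylor (w : C) :
  disk w ->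
  taylor_on_disk (szego w) (fun k => RtoC (sqrt (1 - Cmod w ^ 2)) * Cconj w ^ k)%C.
Proof.
  intros Hw z Hz. apply is_pseries_C. set (d := sqrt (1 - Cmod w ^ 2)).
  assert (Hg : Cmod (Cconj w * z)%C < 1).
  { unfold disk in *. rewrite Cmod_mult, Cmod_conj.
    pose proof (Cmod_ge_0 w). pose proof (Cmod_ge_0 z). nra. }
  pose proof (is_series_scal (K := C_AbsRing) (V := C_NormedModule) (RtoC d) _ _
    (is_series_geom_C _ Hg)) as H.
  eapply is_series_ext; [|exact H]. intros k. cbv beta.
  rewrite Cpow_mult_l. change (RtoC d * (Cconj w ^ k * z ^ k) = RtoC d * Cconj w ^ k * z ^ k)%C.
  ring.
Qed.

Lemma szego_norm_series (w : C) :
  disk w ->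
  is_series (fun k => Cmod (RtoC (sqrt (1 - Cmod w ^ 2)) * Cconj w ^ k)%C ^ 2) 1.
Proof.
  intros Hw. pose proof (disk_defect_pos w Hw) as Hd.
  assert (Hq : Rabs (Cmod w ^ 2) < 1) by (rewrite Rabs_pos_eq; [lra|apply pow2_ge_0]).
  pose proof (is_series_scal (K := R_AbsRing) (V := R_NormedModule)
    (1 - Cmod w ^ 2) _ _ (is_series_geom _ Hq)) as H.
  change (scal (K := R_AbsRing) (V := R_NormedModule) (1 - Cmod w ^ 2) (/ (1 - Cmod w ^ 2)))
    with ((1 - Cmod w ^ 2) * / (1 - Cmod w ^ 2)) in H.
  rewrite Rinv_r in H by lra.
  eapply is_series_ext; [|exact H]. intros k. cbv beta.
  rewrite Cmod_mult, Cmod_pow, Cmod_conj, Cmod_R, Rabs_pos_eq by apply sqrt_pos.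
  rewrite Rpow_mult_distr, pow2_sqrt by lra.
  change (scal (1 - Cmod w ^ 2) ((Cmod w ^ 2) ^ k))
    with ((1 - Cmod w ^ 2) * ((Cmod w ^ 2) ^ k)).
  f_equal. rewrite <- !pow_mult. f_equal. lia.
Qed.

(** Conjugating the kernel coefficients turns the pairing into a multiple of the Taylor series of
    [g] at [w]. The complex series is then split, since [h2inner] sums real and imaginary parts
    separately. *)
Lemma szego_reproducing (g : C -> C) (w : C) :
  hardy2 g -> disk w ->
  h2inner g (szego w) = (RtoC (sqrt (1 - Cmod w ^ 2)) * g w)%C.
Proof.
  intros (b & Hb & _) Hw. unfold h2inner.
  rewrite (coeffs_eq _ _ Hb), (coeffs_eq _ _ (szego_taylor w Hw)).
  set (d := sqrt (1 - Cmod w ^ 2)).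
  pose proof (is_series_scal (K := C_AbsRing) (V := C_NormedModule) (RtoC d) _ _
    (proj1 (is_pseries_C _ _ _) (Hb w Hw))) as H.
  assert (H' : is_series (K := C_AbsRing) (V := C_NormedModule)
    (fun k => b k * Cconj (RtoC d * Cconj w ^ k))%C (RtoC d * g w)%C).
  { eapply is_series_ext; [|exact H]. intros k. cbv beta.
    rewrite Cmult_conj, Cpow_conj, Cconj_conj.
    replace (Cconj (RtoC d)) with (RtoC d)
      by (unfold Cconj, RtoC; simpl; f_equal; ring).
    change (RtoC d * (b k * w ^ k) = b k * (RtoC d * w ^ k))%C. ring. }
  destruct (is_series_C _ _ H') as [H1 H2].
  rewrite (is_series_unique _ _ H1), (is_series_unique _ _ H2).
  symmetry. apply surjective_pairing.
Qed.

Lemma numerical_range_szego (T : (C -> C) -> C -> C) (w : C) :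
  (forall f, hardy2 f -> hardy2 (T f)) -> disk w ->
  numerical_range T (RtoC (sqrt (1 - Cmod w ^ 2)) * T (szego w) w)%C.
Proof.
  intros HT Hw. pose proof (szego_norm_series w Hw) as Hn.
  assert (Hh : hardy2 (szego w)).
  { exists (fun k => RtoC (sqrt (1 - Cmod w ^ 2)) * Cconj w ^ k)%C.
    split; [apply szego_taylor, Hw|]. exists 1. exact Hn. }
  exists (szego w). split; [exact Hh|]. split.
  - unfold h2norm. rewrite (coeffs_eq _ _ (szego_taylor w Hw)).
    rewrite (is_series_unique _ _ Hn). apply sqrt_1.
  - symmetry. apply szego_reproducing; [apply HT, Hh|exact Hw].
Qed.

(** * Uniform constants and the contradiction for sums of weighted composition operators *)

Lemma uniform_pos (P : nat -> R -> Prop) (n : nat) :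
  (forall j r r', P j r -> r' <= r -> P j r') ->
  (forall j, (j <= n)%nat -> exists r, 0 < r /\ P j r) ->
  exists r, 0 < r /\ forall j, (j <= n)%nat -> P j r.
Proof.
  intros Hmono. induction n as [|n IH]; intros H.
  - destruct (H 0%nat ltac:(lia)) as (r & Hr & HP). exists r. split; [exact Hr|].
    intros j Hj. replace j with 0%nat by lia. exact HP.
  - destruct IH as (r & Hr & HP); [intros; apply H; lia|].
    destruct (H (S n) ltac:(lia)) as (r' & Hr' & HP').
    exists (Rmin r r'). split; [apply Rmin_pos; assumption|]. intros j Hj.
    destruct (Nat.eq_dec j (S n)) as [->|].
    + apply (Hmono _ _ _ HP'), Rmin_r.
    + apply (Hmono _ r); [apply HP; lia|apply Rmin_l].
Qed.

Theorem theorem3p2 (n : nat) (hn : (1 <= n)%nat) (phi psi : nat -> C -> C)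
    (phi_analytic : forall j : nat, (1 <= j <= n)%nat -> analytic_on_disk (phi j))
    (phi_self : forall j : nat, (1 <= j <= n)%nat ->
       forall z : C, disk z -> disk (phi j z))
    (phi_not_id : forall j : nat, (1 <= j <= n)%nat ->
       ~ (forall z : C, disk z -> phi j z = z))
    (psi_analytic : forall j : nat, (1 <= j <= n)%nat -> analytic_on_disk (psi j))
    (M_bounded : bounded_on_hardy2 (sum_wcomp n psi phi)) :
  closure_C (numerical_range (sum_wcomp n psi phi)) (RtoC 0).
Proof.
  intros eps Heps. apply NNPP. intros Hno.
  destruct M_bounded as [HM _].
  assert (HME : forall f w, sum_wcomp n psi phi f w
    = csum (fun j => psi (S j) w * f (phi (S j) w))%C n).
  { intros f w. unfold sum_wcomp, wcomp. apply sum_n_m_csum. }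
  assert (Hfar : forall w, disk w -> eps <=
    sqrt (1 - Cmod w ^ 2) * Cmod (sum_wcomp n psi phi (szego w) w)).
  { intros w Hw. apply Rnot_lt_le. intros Hlt. apply Hno.
    eexists. split; [apply (numerical_range_szego _ w HM Hw)|].
    match goal with |- Cmod (?x - _)%C < _ => replace (x - RtoC 0)%C with x by ring end.
    rewrite Cmod_mult, Cmod_R, Rabs_pos_eq by apply sqrt_pos. exact Hlt. }
  (* One growth constant [c] for the images of all monomials [z^k] with [k <= n]; their values at
     [w] are the moments bounded here. *)
  destruct (uniform_pos (fun k r => forall w, disk w ->
    r * ((1 - Cmod w ^ 2) * Cmod (csum (fun j => psi (S j) w * phi (S j) w ^ k) n)%C)
    <= sqrt (1 - Cmod w ^ 2)) n) as (c & Hc & Hmom).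
  { intros k r r' H Hr w Hw. apply Rle_trans with (2 := H w Hw).
    apply Rmult_le_compat_r; [|exact Hr]. pose proof (disk_defect_pos w Hw).
    apply Rmult_le_pos; [lra|apply Cmod_ge_0]. }
  { intros k _. destruct (hardy2_growth _ (HM _ (hardy2_Cpow k))) as (r & Hr & H).
    exists r. split; [exact Hr|]. intros w Hw. specialize (H w Hw). rewrite HME in H. exact H. }
  (* A small positive real [w0] lies in all the punctured neighbourhoods at once. The guard [1 <= j]
     makes index 0 vacuous, as the maps are numbered from 1. *)
  assert (Hw0 : exists (w0 : C) (kap : R), disk w0 /\ 0 < kap /\
    forall j, (j < n)%nat -> kap <= Cmod (w0 - phi (S j) w0)%C).
  { destruct (uniform_pos (fun j r => (1 <= j)%nat ->
      forall z, z <> RtoC 0 -> Cmod z < r -> (z - 1 * phi j z)%C <> RtoC 0) n)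
      as (r & Hr & Hz).
    - intros j r r' H Hr Hj z Hz Hlt. apply H; [exact Hj|exact Hz|lra].
    - intros [|j] Hj; [exists 1; split; [lra|lia]|].
      destruct (analytic_punctured_nonzero (fun z => z - 1 * phi (S j) z)%C)
        as (r & Hr & H).
      + apply analytic_id_minus_scal, phi_analytic. lia.
      + intros E. apply (phi_not_id (S j) ltac:(lia)). intros z Hz. specialize (E z Hz).
        replace (phi (S j) z) with (z - (z - 1 * phi (S j) z))%C by ring. rewrite E. ring.
      + exists r. split; [exact Hr|]. intros _. exact H.
    - pose proof (Rmin_l 1 r). pose proof (Rmin_r 1 r).
      assert (0 < Rmin 1 r) by (apply Rmin_pos; lra).
      set (w0 := RtoC (Rmin 1 r / 2)).
      assert (Hm : Cmod w0 = Rmin 1 r / 2) by (unfold w0; rewrite Cmod_R, Rabs_pos_eq; lra).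
      assert (Hw0 : w0 <> RtoC 0) by (apply Cmod_gt_0; lra).
      destruct (uniform_pos (fun j k => (1 <= j)%nat -> k <= Cmod (w0 - phi j w0)%C) n)
        as (kap & Hkap & Hk).
      + intros j k k' H' Hk Hj. specialize (H' Hj). lra.
      + intros [|j] Hj; [exists 1; split; [lra|lia]|].
        exists (Cmod (w0 - phi (S j) w0)%C). split; [|intros _; lra].
        apply Cmod_gt_0. replace (w0 - phi (S j) w0)%C with (w0 - 1 * phi (S j) w0)%C by ring.
        apply Hz; [lia|lia|exact Hw0|lra].
      + exists w0, kap. split; [unfold disk; lra|]. split; [exact Hkap|].
        intros j Hj. apply Hk; lia. }
  destruct Hw0 as (w0 & kap & Hw0 & Hkap & Hsep). unfold disk in Hw0.
  pose proof (Cmod_ge_0 w0) as Hw0p.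
  assert (H3 : 0 < 3 ^ n) by (apply pow_lt; lra).
  assert (Hk2 : 0 < (kap / 2) ^ n) by (apply pow_lt; lra).
  (* On the circle, [eps <= d^2 Q] and [P Q <= 3^n / (c d)] will combine to [P <= c' d]. *)
  set (c' := 3 ^ n / (c * eps)).
  assert (Hc' : 0 < c') by (apply Rdiv_lt_0_compat; nra).
  (* [d] is the value of [sqrt (1 - |w|^2)] on the circle to be used. The four bounds respectively
     put [w0] inside that circle, preserve half of its separation [kap], keep [s] positive, and make
     [c' d] smaller than the lower bound for the product at [w0]. *)
  set (d := Rmin (Rmin (1 - Cmod w0) (kap / 2)) (Rmin 1 ((kap / 2) ^ n / c')) / 2).
  assert (Hd : 0 < d /\ d < 1 - Cmod w0 /\ d < kap / 2 /\ d < 1 /\ d < (kap / 2) ^ n / c').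
  { assert (0 < (kap / 2) ^ n / c') by (apply Rdiv_lt_0_compat; lra).
    pose proof (Rmin_l (Rmin (1 - Cmod w0) (kap / 2)) (Rmin 1 ((kap / 2) ^ n / c'))).
    pose proof (Rmin_r (Rmin (1 - Cmod w0) (kap / 2)) (Rmin 1 ((kap / 2) ^ n / c'))).
    pose proof (Rmin_l (1 - Cmod w0) (kap / 2)). pose proof (Rmin_r (1 - Cmod w0) (kap / 2)).
    pose proof (Rmin_l 1 ((kap / 2) ^ n / c')). pose proof (Rmin_r 1 ((kap / 2) ^ n / c')).
    assert (0 < Rmin (Rmin (1 - Cmod w0) (kap / 2)) (Rmin 1 ((kap / 2) ^ n / c')))
      by (repeat apply Rmin_pos; lra).
    unfold d. lra. }
  clearbody d. destruct Hd as (Hd0 & Hdw & Hdk & Hd1 & Hdc).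
  set (s := 1 - d ^ 2). set (r := sqrt s).
  assert (Hs : 0 < s < 1) by (unfold s; simpl; nra).
  assert (Hrs : r ^ 2 = s) by (apply pow2_sqrt; lra).
  assert (Hr : 0 < r) by (apply sqrt_lt_R0; lra).
  assert (Hr1 : r < 1) by nra.
  assert (Hw0r : Cmod w0 <= r).
  { apply Rnot_lt_le. intros Hlt. unfold s in *. simpl in *. nra. }
  assert (Hcs : Cmod (RtoC s) = s) by (rewrite Cmod_R, Rabs_pos_eq; lra).
  assert (Hphi : forall z j, Cmod z <= r -> (j < n)%nat -> Cmod (phi (S j) z) < 1).
  { intros z j Hz Hj. apply phi_self; [lia|]. unfold disk. lra. }
  (* Maximum modulus carries the estimate from the circle to [w0]; each factor has modulus at most
     2, whence the crude bound [2^n]. *)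
  assert (Hupper : Cmod (cprod (fun j => w0 - RtoC s * phi (S j) w0) n)%C <= c' * d).
  { apply (max_modulus (fun z => cprod (fun j => z - RtoC s * phi (S j) z) n)%C r _ (2 ^ n)).
    - exact Hr.
    - nra.
    - intros z Hz. apply (cprod_quadratic_at (fun j z => z - RtoC s * phi (S j) z)%C).
      intros j Hj. apply analytic_quadratic_at; [|unfold disk; lra].
      apply analytic_id_minus_scal, phi_analytic. lia.
    - intros z Hz. apply Cmod_cprod_le. intros j Hj.
      eapply Rle_trans; [apply Cmod_triangle|]. rewrite Cmod_opp, Cmod_mult, Hcs.
      pose proof (Hphi z j Hz Hj). pose proof (Cmod_ge_0 (phi (S j) z)). nra.
    - intros w Hw.
      assert (Hwd : disk w) by (unfold disk; lra).
      assert (Hdef : sqrt (1 - Cmod w ^ 2) = d).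
      { rewrite Hw, Hrs. unfold s. replace (1 - (1 - d ^ 2)) with (d ^ 2) by ring.
        apply sqrt_pow2. lra. }
      (* On this circle [w (1 - conj(w) phi_j(w)) = w - s phi_j(w)]: fixing [s] removes the
         conjugate and leaves a function analytic in [w]. *)
      assert (Hww : RtoC s = (Cconj w * w)%C).
      { rewrite Cmult_comm, <- Cmod2_conj, Hw, Hrs. reflexivity. }
      assert (Hwne : w <> RtoC 0) by (apply Cmod_gt_0; lra).
      assert (Hne : forall j, (j < n)%nat ->
        (w - RtoC s * phi (S j) w)%C <> RtoC 0).
      { intros j Hj. rewrite Hww.
        replace (w - Cconj w * w * phi (S j) w)%C with (w * (1 - Cconj w * phi (S j) w))%C by ring.
        apply Cmult_neq_0; [exact Hwne|].
        apply one_minus_conj_mult_neq_0; [exact Hwd|]. apply phi_self; [lia|exact Hwd]. }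
      pose proof (resolvent_sum_bound w (RtoC s) (fun j => phi (S j) w)
        (fun j => psi (S j) w) n (/ (c * d))) as Hb.
      specialize (Hb ltac:(lra) ltac:(lra)
        ltac:(intros j Hj; left; apply Hphi; [lra|exact Hj]) Hne).
      set (P := Cmod (cprod (fun j => w - RtoC s * phi (S j) w) n)%C) in *.
      assert (HP : 0 <= P) by apply Cmod_ge_0.
      set (Q := Cmod (csum (fun j => psi (S j) w / (w - RtoC s * phi (S j) w)) n)%C) in *.
      assert (HQ : 0 <= Q) by apply Cmod_ge_0.
      assert (HPQ : P * Q <= 3 ^ n * / (c * d)).
      { apply Hb. intros k Hk. specialize (Hmom k Hk w Hwd).
        rewrite Hdef in Hmom. replace (1 - Cmod w ^ 2) with (d ^ 2) in Hmom
          by (rewrite Hw, Hrs; unfold s; ring).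
        apply (Rmult_le_reg_l (c * d ^ 2)); [apply Rmult_lt_0_compat; [lra|apply pow_lt; lra]|].
        replace (c * d ^ 2 * / (c * d)) with d by (field; lra). lra. }
      (* One factor [d] comes from the reproducing property and one from the normalisation of the
         kernel. The remaining factor [|w| = r] is less than 1. *)
      assert (HQe : eps <= d ^ 2 * Q).
      { pose proof (Hfar w Hwd) as Hf. rewrite HME in Hf. unfold szego in Hf.
        rewrite Hdef in Hf.
        rewrite (csum_ext _ (fun j => (RtoC d * w)
          * (psi (S j) w / (w - RtoC s * phi (S j) w)))%C) in Hf.
        - rewrite csum_scal, !Cmod_mult, Cmod_R, Rabs_pos_eq, Hw in Hf by lra.
          fold Q in Hf. assert (0 <= d * d * Q * (1 - r)); [|nra].
          apply Rmult_le_pos; [|lra]. apply Rmult_le_pos; [nra|exact HQ].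
        - intros j Hj. specialize (Hne j Hj). rewrite Hww in Hne |- *.
          field. split; [exact Hne|].
          apply one_minus_conj_mult_neq_0; [exact Hwd|]. apply phi_self; [lia|exact Hwd]. }
      fold P. apply (Rmult_le_reg_l eps); [exact Heps|].
      replace (eps * (c' * d)) with (d ^ 2 * (3 ^ n * / (c * d)))
        by (unfold c'; field; lra).
      apply Rle_trans with (d ^ 2 * (P * Q)); [nra|].
      apply Rmult_le_compat_l; [apply pow2_ge_0|exact HPQ].
    - exact Hw0r. }
  (* Replacing 1 by [s] in front of [phi_j(w0)] moves each factor by at most [d^2], hence by less
     than [kap / 2]. *)
  assert (Hlower : (kap / 2) ^ n <= Cmod (cprod (fun j => w0 - RtoC s * phi (S j) w0) n)%C).
  { apply Cmod_cprod_ge; [lra|]. intros j Hj. specialize (Hsep j Hj).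
    pose proof (Hphi w0 j Hw0r Hj). pose proof (Cmod_ge_0 (phi (S j) w0)).
    assert (Cmod (w0 - phi (S j) w0)%C <= Cmod (w0 - RtoC s * phi (S j) w0)%C
      + d ^ 2 * Cmod (phi (S j) w0)).
    { replace (w0 - phi (S j) w0)%C
        with ((w0 - RtoC s * phi (S j) w0) + - (RtoC (d ^ 2) * phi (S j) w0))%C
        by (unfold s; rewrite RtoC_minus; ring).
      eapply Rle_trans; [apply Cmod_triangle|].
      rewrite Cmod_opp, Cmod_mult, Cmod_R, Rabs_pos_eq by apply pow2_ge_0. lra. }
    assert (d ^ 2 * Cmod (phi (S j) w0) <= d) by (simpl; nra). lra. }
  apply (Rmult_lt_compat_l c') in Hdc; [|exact Hc'].
  replace (c' * ((kap / 2) ^ n / c')) with ((kap / 2) ^ n) in Hdc by (field; lra).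
  lra.
Qed.
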